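(* Let $\mathbf{y} \in \mathbb{R}^n$, let $f = \mathrm{softmax} : \mathbb{R}^n \to \mathbb{R}^n$, and let $\mathbf{z} = f(\mathbf{y})$. Let $\mathbf{q} \in \{0,1\}^n$ be such that $\mathbf{q} \neq (1,\ldots,1)^{\top}$, and denote by $\Omega = \{ i : q_i \neq 0 \}$ its support. Then $$\kappa_1(f, \mathbf{y}; \mathbf{q}) = 2 \max_{j \notin \Omega} z_j (1 - z_j) |y_j|.$$
   Context: The softmax function $\mathrm{softmax} : \mathbb{R}^n \to \mathbb{R}^n$ has components $\mathrm{softmax}(\mathbf{y})_i = \exp(y_i) / \sum_{l=1}^n \exp(y_l)$. For a differentiable $f : \mathbb{R}^n \to \mathbb{R}^n$ with Jacobian matrix $\mathbf{J}_f(\mathbf{y})$ at $\mathbf{y}$, set $\mathbf{K}(f,\mathbf{y}) = \mathbf{J}_f(\mathbf{y})\, \mathrm{diag}(\mathbf{y})$. For $\mathbf{q} \in \{0,1\}^n$ and $f(\mathbf{y}) \ne 0$ define $$\kappa_1(f,\mathbf{y};\mathbf{q}) = \frac{\big\| \mathbf{K}(f,\mathbf{y}) (\mathbf{I} - \mathrm{diag}(\mathbf{q})) \big\|_{1,1}}{\|f(\mathbf{y})\|_1},$$ where $\|\cdot\|_{1,1}$ is the operator norm from $\ell_1$ to $\ell_1$, i.e. the maximum absolute column sum, $\mathrm{diag}(\mathbf{v})$ is the diagonal matrix with diagonal $\mathbf{v}$, and $\mathbf{I}$ is the identity matrix. *)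

(* Defs.v *)
From HB Require Import structures.
From mathcomp Require Import all_boot all_order all_algebra.
From mathcomp Require Import boolp classical_sets reals topology normedtype.
From mathcomp Require Import sequences derive exp.

Set Implicit Arguments.
Unset Strict Implicit.
Unset Printing Implicit Defensive.

Import Order.TTheory GRing.Theory Num.Theory.
Import numFieldTopology.Exports numFieldNormedType.Exports.
Local Open Scope classical_set_scope.
Local Open Scope ring_scope.

(* Vectors of R^n are row vectors, as required by the library's [jacobian].
   Matrices follow the usual column convention (entry (i, j) of a Jacobian is
   the partial derivative of f_i in the direction j), so a matrix A maps the
   vector represented by the row x to the one represented by x *m A^T. *)

Definition softmax (R : realType) (n : nat) (y : 'rV[R]_n) : 'rV[R]_n :=
  \row_i (expR (y 0 i) / \sum_(l < n) expR (y 0 l)).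

Definition norm1 (R : realType) (n : nat) (x : 'rV[R]_n) : R :=
  \sum_(i < n) `|x 0 i|.

(* Operator norm of A from l_1 to l_1. *)
Definition opnorm11 (R : realType) (m n : nat) (A : 'M[R]_(m, n)) : R :=
  sup [set norm1 (x *m A^T) | x in [set x : 'rV[R]_n | norm1 x <= 1]].

(* [jacobian f y] acts on row vectors by right multiplication, hence it is the
   transpose of the usual Jacobian matrix. *)
Definition Jac (R : realType) (n : nat) (f : 'rV[R]_n -> 'rV[R]_n)
    (y : 'rV[R]_n) : 'M[R]_n :=
  (jacobian f y)^T.

Definition Kmx (R : realType) (n : nat) (f : 'rV[R]_n -> 'rV[R]_n)
    (y : 'rV[R]_n) : 'M[R]_n :=
  Jac f y *m diag_mx y.

(* Meaningful when f is differentiable at y, f y != 0 and q has entries in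
   {0, 1}. *)
Definition kappa1 (R : realType) (n : nat) (f : 'rV[R]_n -> 'rV[R]_n)
    (y q : 'rV[R]_n) : R :=
  opnorm11 (Kmx f y *m (1%:M - diag_mx q)) / norm1 (f y).

Definition vsupp (R : realType) (n : nat) (q : 'rV[R]_n) : {set 'I_n} :=
  [set i | q 0 i != 0]%SET.

(* Main.v *)
(* The softmax Jacobian has entries z_i ([i = j] - z_j), so its j-th column has
   absolute sum z_j (1 - z_j) + z_j (sum of the z_i, i <> j) = 2 z_j (1 - z_j).
   Right multiplication by the two diagonal matrices scales that column by
   y_j (1 - q_j), which kills the columns in the support of q, and
   the denominator of kappa_1 is 1. *)

Require Import Defs.
From HB Require Import structures.
From mathcomp Require Import all_boot all_order all_algebra.
From mathcomp Require Import boolp classical_sets functions reals topology normedtype.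
From mathcomp Require Import sequences derive exp.

Set Implicit Arguments.
Unset Strict Implicit.
Unset Printing Implicit Defensive.

Import Order.TTheory GRing.Theory Num.Theory.
Import numFieldTopology.Exports numFieldNormedType.Exports.
Local Open Scope ring_scope.

Lemma norm1_ge0 (R : realType) (n : nat) (x : 'rV[R]_n) : 0 <= norm1 x.
Proof. exact: sumr_ge0. Qed.

Lemma norm1_delta (R : realType) (n : nat) (j : 'I_n) :
  norm1 (delta_mx 0 j : 'rV[R]_n) = 1.
Proof.
rewrite /norm1 (bigD1 j)//= mxE !eqxx normr1 big1 ?addr0// => i /negbTE ij.
by rewrite mxE ij andbF normr0.
Qed.

(** By the triangle inequality and an exchange of sums, each [|x 0 j|] ends up weighted by the
    absolute sum of column j. *)
Lemma norm1_mulmxT_le (R : realType) (m n : nat) (A : 'M[R]_(m, n)) (c : R) :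
  (forall j, \sum_i `|A i j| <= c) ->
  forall x : 'rV[R]_n, norm1 (x *m A^T) <= c * norm1 x.
Proof.
move=> Ac x; rewrite /norm1 mulr_sumr.
apply: (@le_trans _ _ (\sum_i \sum_j `|x 0 j * A i j|)).
  apply: ler_sum => i _; rewrite mxE; apply: le_trans (ler_norm_sum _ _ _) _.
  by apply: ler_sum => j _; rewrite mxE.
rewrite exchange_big; apply: ler_sum => j _ /=.
under eq_bigr do rewrite normrM.
by rewrite -mulr_sumr mulrC ler_wpM2r.
Qed.

(** Column sums bound the image of the unit ball, and the basis vector [delta_mx 0 j] attains the
    sum of column j. *)
Lemma opnorm11E (R : realType) (m n : nat) (A : 'M[R]_(m, n)) :
  opnorm11 A = \big[Num.max/0]_j \sum_i `|A i j|.
Proof.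
set c := \big[Num.max/0]_j _.
have c_ge0 : 0 <= c by exact: bigmax_ge_id.
have c_ub : ubound [set norm1 (x *m A^T) |
    x in [set x : 'rV[R]_n | norm1 x <= 1]] c.
  move=> _ [x /= x_le1 <-]; apply: (@le_trans _ _ (c * norm1 x)).
    by apply: norm1_mulmxT_le => j; exact: le_bigmax.
  by rewrite ler_piMr.
apply/eqP; rewrite eq_le; apply/andP; split.
  apply: ge_sup c_ub; exists (norm1 ((0 : 'rV[R]_n) *m A^T)).
  by exists 0 => //=; rewrite /norm1 big1// => i _; rewrite mxE normr0.
(* The default value 0 must also lie below the supremum, even when there are no columns; the zero
   vector witnesses this. *)
apply: bigmax_le => [|j _].
  apply: (@le_trans _ _ (norm1 ((0 : 'rV[R]_n) *m A^T))); first exact: norm1_ge0.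
  apply: ub_le_sup; first by exists c.
  by exists 0 => //=; rewrite /norm1 big1// => i _; rewrite mxE normr0.
apply: ub_le_sup; first by exists c.
exists (delta_mx 0 j); first by rewrite /= norm1_delta.
by rewrite -rowE; apply: eq_bigr => i _; rewrite !mxE.
Qed.

Lemma differentiable_expR_coord (R : realType) (n : nat) (y : 'rV[R]_n)
    (l : 'I_n) :
  differentiable (fun x : 'rV[R]_n => expR (x 0 l)) y.
Proof.
apply: (@differentiable_comp _ _ _ _ (fun x : 'rV[R]_n => x 0 l) expR).
  exact: differentiable_coord.
by apply/derivable1_diffP; exact: derivable_expR.
Qed.

Lemma is_derive_expR_coord (R : realType) (n : nat) (y v : 'rV[R]_n)
    (l : 'I_n) :
  is_derive y v (fun x : 'rV[R]_n => expR (x 0 l)) (expR (y 0 l) * v 0 l).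
Proof.
have dcoord := @differentiable_coord R 1 n y 0 l.
have dexp : differentiable (@expR R) (y 0 l).
  by apply/derivable1_diffP; exact: derivable_expR.
have := diff_derivable (v := v) (differentiable_expR_coord y l).
move=> /derivableP dE; apply: (is_derive_eq dE).
rewrite deriveE; last exact: differentiable_expR_coord.
rewrite (@diff_comp _ _ _ _ (fun x : 'rV[R]_n => x 0 l) expR)//=.
rewrite diff1E// derive1E derive_val -deriveE// mulrC; congr (_ * _).
(* The derivative of a coordinate along v is read off entrywise from that of the identity. *)
have := @derive_mx R _ 1 n id y v (@derivable_id _ _ y v).
by rewrite derive_id => /(congr1 (fun A : 'rV[R]_n => A 0 l)); rewrite mxE => ->.
Qed.

Section softmax.
Context (R : realType) (n : nat).
Implicit Types y v : 'rV[R]_n.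

Let S y := \sum_(l < n) expR (y 0 l).

(** The index i serves only to witness that the sum is nonempty. *)
Lemma softmax_den_gt0 y (i : 'I_n) : 0 < S y.
Proof.
by rewrite /S (bigD1 i)//= ltr_pwDl ?expR_gt0// sumr_ge0// => l _; exact: expR_ge0.
Qed.

Lemma softmax_gt0 y (i : 'I_n) : 0 < softmax y 0 i.
Proof. by rewrite mxE divr_gt0 ?expR_gt0 ?(softmax_den_gt0 y i). Qed.

Lemma sum_softmax y : (0 < n)%N -> \sum_i softmax y 0 i = 1.
Proof.
move=> n_gt0; under eq_bigr do rewrite mxE.
by rewrite -mulr_suml divff// gt_eqF// (softmax_den_gt0 y (Ordinal n_gt0)).
Qed.

Lemma norm1_softmax y : (0 < n)%N -> norm1 (softmax y) = 1.
Proof.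
move=> n_gt0; rewrite -(sum_softmax y n_gt0); apply: eq_bigr => i _.
by rewrite gtr0_norm// softmax_gt0.
Qed.

Lemma softmax_le1 y (i : 'I_n) : softmax y 0 i <= 1.
Proof.
rewrite -(sum_softmax y (leq_ltn_trans (leq0n i) (ltn_ord i))).
by rewrite (bigD1 i)//= lerDl sumr_ge0// => l _; rewrite ltW// softmax_gt0.
Qed.

Let fun_softmax_den : S = \sum_(l < n) (fun y : 'rV[R]_n => expR (y 0 l)).
Proof. by apply/funext => y; rewrite fct_sumE. Qed.

Lemma differentiable_softmax y : differentiable (@softmax R n) y.
Proof.
(* Expanding in the standard basis reduces the claim to real-valued quotients. *)
have -> : @softmax R n =
    \sum_(i < n) (fun x : 'rV[R]_n => (expR (x 0 i) * (S x)^-1) *: delta_mx 0 i).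
  apply/funext => x; rewrite fct_sumE; apply/rowP => k.
  rewrite summxE [RHS](bigD1 k)//= [X in _ + X]big1 ?addr0 ?mxE ?eqxx ?mulr1// => l /negbTE kl.
  by rewrite !mxE eq_sym kl andbF mulr0.
apply: differentiable_sum => i; apply: differentiableZl.
apply: (@differentiableM _ _ _ (fun x => (S x)^-1)).
  exact: differentiable_expR_coord.
apply: differentiableV; last by rewrite gt_eqF// (softmax_den_gt0 y i).
rewrite fun_softmax_den; apply: differentiable_sum => l.
exact: differentiable_expR_coord.
Qed.

(** Product rule for [expR (x 0 i)] and [(S x)^-1]: the first factor yields the Kronecker term, the
    second yields - z_i z_j. *)
Lemma derive_softmax_coord y (i j : 'I_n) :
  'D_(delta_mx 0 j) (fun x => softmax x 0 i) y =
  softmax y 0 i * ((i == j)%:R - softmax y 0 j).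
Proof.
set v : 'rV[R]_n := delta_mx 0 j.
have S_neq0 : S y != 0 by rewrite gt_eqF// (softmax_den_gt0 y i).
have dE := is_derive_expR_coord y v.
have dS : is_derive y v S (expR (y 0 j)).
  rewrite fun_softmax_den; apply: is_derive_eq.
  rewrite (bigD1 j)//= mxE !eqxx mulr1 big1 ?addr0// => l /negbTE jl.
  by rewrite mxE jl andbF mulr0.
have -> : (fun x => softmax x 0 i) =
    (fun x : 'rV[R]_n => expR (x 0 i)) * (fun x => (S x)^-1).
  by apply/funext => x; rewrite mxE.
rewrite deriveM; [|exact: ex_derive|exact: derivableV].
rewrite deriveV// !derive_val !mxE/= -/(S y) eq_sym.
rewrite /GRing.scale/= mulrBr addrC; congr (_ + _).
  by rewrite mulrA [_^-1 * _]mulrC.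
by rewrite mulNr mulrN mulrACA -invfM -expr2 [_ ^- 2 * _]mulrC mulrA.
Qed.

Lemma Jac_softmax y (i j : 'I_n) :
  Jac (@softmax R n) y i j = softmax y 0 i * ((i == j)%:R - softmax y 0 j).
Proof.
have dsm := differentiable_softmax y.
rewrite -derive_softmax_coord /Jac mxE.
(* Applied to a basis row vector, [jacobian] returns its j-th row, which is the j-th column of
   [Jac]. *)
have := deriveEjacobian (delta_mx 0 j) dsm.
rewrite derive_mx; last exact: diff_derivable.
by move/(congr1 (fun A : 'rV[R]_n => A 0 i)); rewrite -rowE !mxE.
Qed.

Lemma Jac_softmax_col_sum y (j : 'I_n) :
  \sum_i `|Jac (@softmax R n) y i j| =
  2 * (softmax y 0 j * (1 - softmax y 0 j)).
Proof.
have zj := softmax_gt0 y j.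
under eq_bigr do rewrite Jac_softmax normrM gtr0_norm ?softmax_gt0//.
rewrite (bigD1 j)//= eqxx ger0_norm ?subr_ge0 ?softmax_le1//.
under eq_bigr => i /negbTE ->.
  rewrite sub0r normrN gtr0_norm//; over.
rewrite -mulr_suml mulr2n mulrDl mul1r; congr (_ + _).
rewrite mulrC; congr (_ * _).
(* The off-diagonal z_i add up to 1 - z_j, so they contribute as much as the diagonal entry. *)
rewrite -(sum_softmax y (leq_ltn_trans (leq0n j) (ltn_ord j))).
by rewrite [in RHS](bigD1 j)//= addrAC subrr add0r.
Qed.

End softmax.

(* The maximum is over a nonempty set of nonnegative reals, so the default
   value 0 of the iterated maximum is harmless. *)
Theorem proposition3p3 (R : realType) (n : nat) (y q : 'rV[R]_n)
    (q01 : forall i : 'I_n, q 0 i = 0 \/ q 0 i = 1)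
    (q_neq1 : q <> const_mx 1) :
  let z := softmax y in
  let Omega := vsupp q in
  kappa1 (@softmax R n) y q =
    2 * \big[Num.max/0]_(j < n | j \notin Omega) (z 0 j * (1 - z 0 j) * `|y 0 j|).
Proof.
move=> z Omega.
(* In dimension 0 all vectors coincide, so q would equal the all-ones vector. *)
have n_gt0 : (0 < n)%N.
  rewrite lt0n; apply/eqP => n0; apply: q_neq1; apply/rowP => i.
  by have := ltn_ord i; rewrite {2}n0.
rewrite /kappa1 norm1_softmax// divr1 opnorm11E.
(* The factor 2 moves inside the maximum: it is nonnegative and fixes the default 0. *)
rewrite (big_morph _ (fun a b => maxr_pMr a b (ler0n R 2)) (mulr0 2)).
(* Indices in Omega now contribute 0 on the right, matching the columns killed by q, so the two
   maxima can be compared term by term. *)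
rewrite [RHS]bigmax_mkcond; apply: eq_bigr => j _.
rewrite (_ : 1%:M - diag_mx q = diag_mx (const_mx 1 - q)); last first.
  by rewrite linearB/= diag_const_mx.
under eq_bigr do rewrite /Kmx !mul_mx_diag 2!mxE -mulrA normrM.
rewrite -mulr_suml Jac_softmax_col_sum inE.
rewrite (_ : (const_mx 1 - q) 0 j = 1 - q 0 j); last by rewrite !mxE.
case: (q01 j) => ->; rewrite ?eqxx ?oner_eq0/=.
  by rewrite subr0 mulr1 !mulrA.
by rewrite subrr mulr0 normr0 mulr0.
Qed.
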